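(* Let $\mathcal{S}=\{1,\dots,S\}$, let $\mathcal{Y}^s\subseteq\mathbb{R}^p$, $s\in\mathcal{S}$, be finite non-empty sets, and let $\mathcal{Y}=\bigoplus_{s\in\mathcal{S}}\mathcal{Y}^s$. Given $\lambda\in\mathbb{R}^p_{>}$, let $\mathcal{Y}_\lambda=\arg\min\{\lambda^{\mathrm T}y\mid y\in\mathcal{Y}\}$ and $\mathcal{Y}^s_\lambda=\arg\min\{\lambda^{\mathrm T}y\mid y\in\mathcal{Y}^s\}$. Then the following hold. 1. If $y=y^1+\dots+y^S$ with $y^s\in\mathcal{Y}^s$ for all $s\in\mathcal{S}$, and $y\in\mathcal{Y}_{\mathrm{s}}$, then $y^s\in\mathcal{Y}^s_{\mathrm{s}}$ for all $s\in\mathcal{S}$. 2. $\mathcal{Y}_\lambda=\bigoplus_{s\in\mathcal{S}}\mathcal{Y}^s_\lambda=(\mathcal{Y}_\lambda)_{\mathrm N}\subseteq\mathcal{Y}_{\mathrm{s}}$.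
   Context: For sets $A^s\subseteq\mathbb{R}^p$, $\bigoplus_{s\in\mathcal{S}}A^s=\{\sum_{s\in\mathcal{S}}a^s\mid a^s\in A^s\}$ is the Minkowski sum. $\mathbb{R}^p_{>}$ is the set of vectors with all components strictly positive. For $u,v\in\mathbb{R}^p$: $u\leqq v$ means $u_i\le v_i$ for all $i$; $u\leq v$ (''$u$ dominates $v$'') means $u\leqq v$ and $u\ne v$. For $A\subseteq\mathbb{R}^p$, the nondominated set is $A_{\mathrm N}=\{a\in A\mid \nexists a'\in A: a'\leq a\}$. For $\lambda\in\mathbb{R}^p_{>}$, $A_\lambda=\arg\min\{\lambda^{\mathrm T}a\mid a\in A\}$ is the set of minimizers, and the set of supported nondominated vectors of $A$ is $A_{\mathrm{s}}=\bigcup_{\lambda\in\mathbb{R}^p_{>}}A_\lambda$; for $A=\mathcal{Y}^s$ it is denoted $\mathcal{Y}^s_{\mathrm{s}}$ (superscript: index of the local set; subscript: ''supported''). *)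

(* Defs.v *)
From mathcomp Require Import all_boot all_order all_algebra.
From mathcomp Require Import classical_sets cardinality reals.
Set Implicit Arguments.
Unset Strict Implicit.
Unset Printing Implicit Defensive.
Import Order.TTheory GRing.Theory Num.Theory.
Local Open Scope classical_set_scope.
Local Open Scope ring_scope.

(* Vectors of R^p are column vectors. [dominates u v] is componentwise <= with
   u <> v, not strict inequality in every component. *)

Definition weakly_dominates (R : realType) (p : nat) (u v : 'cV[R]_p) : Prop :=
  forall i : 'I_p, u i 0 <= v i 0.

Definition dominates (R : realType) (p : nat) (u v : 'cV[R]_p) : Prop :=
  weakly_dominates u v /\ u <> v.

Definition positive_vectors (R : realType) (p : nat) : set 'cV[R]_p :=
  [set l | forall i : 'I_p, 0 < l i 0].

Definition minkowski_sum (R : realType) (p : nat) (I : finType)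
    (A : I -> set 'cV[R]_p) : set 'cV[R]_p :=
  [set y | exists2 a : I -> 'cV[R]_p, (forall s, A s (a s)) & y = \sum_s a s].

Definition nondominated (R : realType) (p : nat) (A : set 'cV[R]_p) :
    set 'cV[R]_p :=
  [set a | A a /\ ~ (exists2 a', A a' & dominates a' a)].

Definition weighted_sum (R : realType) (p : nat) (l a : 'cV[R]_p) : R :=
  (l^T *m a) 0 0.

Definition argmin_weighted (R : realType) (p : nat) (l : 'cV[R]_p)
    (A : set 'cV[R]_p) : set 'cV[R]_p :=
  [set a | A a /\ forall a', A a' -> weighted_sum l a <= weighted_sum l a'].

Definition supported (R : realType) (p : nat) (A : set 'cV[R]_p) :
    set 'cV[R]_p :=
  \bigcup_(l in @positive_vectors R p) argmin_weighted l A.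

(* Main.v *)
Require Import Defs.
From mathcomp Require Import all_boot all_order all_algebra.
From mathcomp Require Import classical_sets cardinality reals.
Import Order.TTheory GRing.Theory Num.Theory.
Local Open Scope classical_set_scope.
Local Open Scope ring_scope.

(** A linear functional is minimized over a Minkowski sum summand by summand:
    replacing a single summand of [\sum_s a s] by another element of its local
    set changes the weighted sum by exactly the change in that summand, so the
    total is minimal if and only if every summand is minimal in its own set
    ([argmin_summand] is the nontrivial direction, [argmin_minkowski_sum] the
    resulting equality).  Since the same weight vector serves all the local
    sets, supportedness passes from the sum to its summands.

    For a strictly positive weight vector, a dominating vector has a strictly
    smaller weighted sum ([weighted_sum_lt]).  Vectors that share the same
    minimal weighted sum therefore cannot dominate each other, so a set of
    minimizers is its own nondominated set ([nondominated_argmin]). *)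

Lemma weighted_sumE {R : realType} {p : nat} (l a : 'cV[R]_p) :
  weighted_sum l a = \sum_i l i 0 * a i 0.
Proof. by rewrite /weighted_sum mxE; apply: eq_bigr => i _; rewrite mxE. Qed.

Lemma weighted_sum_sum {R : realType} {p : nat} {I : finType} (l : 'cV[R]_p)
    (a : I -> 'cV[R]_p) :
  weighted_sum l (\sum_s a s) = \sum_s weighted_sum l (a s).
Proof. by rewrite /weighted_sum mulmx_sumr summxE. Qed.

(** Strict positivity of [l] matters here: [u] and [v] may differ in a single
    component, and that component must carry a nonzero weight. *)
Lemma weighted_sum_lt {R : realType} {p : nat} (l u v : 'cV[R]_p) :
  positive_vectors l -> dominates u v -> weighted_sum l u < weighted_sum l v.
Proof.
move=> lpos [leuv neq_uv]; rewrite !weighted_sumE.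
have le_term i : l i 0 * u i 0 <= l i 0 * v i 0.
  by rewrite ler_pM2l // lpos.
rewrite lt_neqAle ler_sum // andbT; apply/negP => /eqP eq_sum.
(* Termwise inequalities with equal totals are all equalities. *)
have /eqP := eq_sum; rewrite eq_sym -subr_eq0 -sumrB psumr_eq0; last first.
  by move=> i _; rewrite subr_ge0.
move=> /allP eq_term; apply: neq_uv; apply/colP => i.
have := eq_term i (mem_index_enum i); rewrite /= subr_eq0 => /eqP.
by move/(mulfI (lt0r_neq0 (lpos i))).
Qed.

Lemma nondominated_argmin {R : realType} {p : nat} (l : 'cV[R]_p)
    (A : set 'cV[R]_p) :
  positive_vectors l ->
  nondominated (argmin_weighted l A) = argmin_weighted l A.
Proof.
move=> lpos; apply/seteqP; split=> a; first by case.
move=> [Aa mina]; split=> // -[b [Ab _] dom_ba].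
by have := lt_le_trans (weighted_sum_lt l b a lpos dom_ba) (mina b Ab); rewrite ltxx.
Qed.

(** If some [b] in [A t] had a smaller weighted sum than [a t], exchanging [a t]
    for [b] would give an element of the Minkowski sum below the minimum. *)
Lemma argmin_summand {R : realType} {p : nat} {I : finType} (l : 'cV[R]_p)
    (A : I -> set 'cV[R]_p) (a : I -> 'cV[R]_p) :
  (forall s, A s (a s)) ->
  argmin_weighted l (minkowski_sum A) (\sum_s a s) ->
  forall t, argmin_weighted l (A t) (a t).
Proof.
move=> Aa [_ mina] t; split=> // b Ab.
pose a' s := if s == t then b else a s.
have Aa' s : A s (a' s) by rewrite /a'; case: eqP => [->|_].
have := mina _ (ex_intro2 _ _ a' Aa' erefl).
rewrite !weighted_sum_sum (bigD1 t) //= [leRHS](bigD1 t) //= /a' eqxx.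
rewrite [X in _ <= _ + X](eq_bigr (fun s => weighted_sum l (a s))).
  by rewrite lerD2r.
by move=> s /negPf ->.
Qed.

Lemma argmin_minkowski_sum {R : realType} {p : nat} {I : finType}
    (l : 'cV[R]_p) (A : I -> set 'cV[R]_p) :
  argmin_weighted l (minkowski_sum A)
    = minkowski_sum (fun s => argmin_weighted l (A s)).
Proof.
apply/seteqP; split=> y.
  move=> miny; have [[a Aa y_sum] _] := miny; exists a => //.
  by apply: argmin_summand => //; rewrite -y_sum.
move=> [a mina ->]; split; first by exists a => // s; case: (mina s).
move=> _ [b Ab ->]; rewrite !weighted_sum_sum; apply: ler_sum => s _.
by case: (mina s) => _; apply.
Qed.

Theorem proposition3p1 (R : realType) (p S : nat) (Y : 'I_S -> set 'cV[R]_p)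
    (Yfin : forall s, finite_set (Y s)) (Yne : forall s, Y s !=set0)
    (l : 'cV[R]_p) (lpos : positive_vectors l) :
  (forall (y : 'cV[R]_p) (ys : 'I_S -> 'cV[R]_p),
      y = \sum_(s < S) ys s -> (forall s, Y s (ys s)) ->
      supported (minkowski_sum Y) y ->
      forall s, supported (Y s) (ys s))
  /\
  [/\ argmin_weighted l (minkowski_sum Y)
        = minkowski_sum (fun s => argmin_weighted l (Y s)),
      minkowski_sum (fun s => argmin_weighted l (Y s))
        = nondominated (argmin_weighted l (minkowski_sum Y))
    & nondominated (argmin_weighted l (minkowski_sum Y))
        `<=` supported (minkowski_sum Y)].
Proof.
split.
  move=> y ys -> Yys [m mpos miny] s.
  by exists m => //; apply: argmin_summand miny s.
rewrite nondominated_argmin // argmin_minkowski_sum; split=> //.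
by rewrite -argmin_minkowski_sum => y miny; exists l.
Qed.
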